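(* Let $k\ge 2$ be the number of copies of the state being tested. The separability test corresponding to the symmetric group $S_k$ can be executed with $O(k^2)$ controlled-SWAP gates, and the separability test corresponding to the cyclic group $C_k=\langle(1\ 2\ \cdots\ k)\rangle\le S_k$ can be executed with $O(k\log k)$ controlled-SWAP gates. The implied constants are absolute (independent of $k$, of the Hilbert spaces and of the tested state).
   Context: Let $\mathcal{H}_A,\mathcal{H}_B$ be finite-dimensional complex Hilbert spaces. For $\pi\in S_k$, $W(\pi)$ is the unitary on $\mathcal{H}_B^{\otimes k}$ permuting the tensor factors: $W(\pi)(v_1\otimes\cdots\otimes v_k)=v_{\pi^{-1}(1)}\otimes\cdots\otimes v_{\pi^{-1}(k)}$. For a subgroup $G\le S_k$, the separability test corresponding to $G$ is a two-outcome (accept/reject) test applied to $k$ copies of a pure bipartite state $|\psi\rangle_{AB}\in\mathcal{H}_A\otimes\mathcal{H}_B$ which accepts with probability $\operatorname{Tr}[\Pi_G\,\rho_B^{\otimes k}]$, where $\rho_B:=\operatorname{Tr}_A[|\psi\rangle\langle\psi|_{AB}]$ and $\Pi_G:=\frac{1}{|G|}\sum_{g\in G}W(g)$. Circuit model: the test is executed by (i) preparing a control register of finitely many qubits in a fixed state $|\chi\rangle$ not depending on the tested state; (ii) applying a sequence of controlled-SWAP gates, each of which has one control qubit in the control register and swaps two (not necessarily adjacent) of the $k$ copies of $\mathcal{H}_B$ if the control qubit is $|1\rangle$ and acts trivially if it is $|0\rangle$; (iii) accepting if and only if a measurement projecting the control register onto $|\chi\rangle$ succeeds. The cost counted is the number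 of controlled-SWAP gates in step (ii); the preparation and measurement of the control register are not counted. *)

(* Defs.v *)
From HB Require Import structures.
From mathcomp Require Import all_boot all_order all_algebra all_fingroup.
From mathcomp Require Import all_classical all_reals all_analysis.
From mathcomp Require Export complex.

Set Implicit Arguments.
Unset Strict Implicit.
Unset Printing Implicit Defensive.

Import Order.TTheory GRing.Theory Num.Theory.
Local Open Scope ring_scope.
Local Open Scope complex_scope.
Local Open Scope sesquilinear_scope.

(* The Hilbert space with an orthonormal basis (|x>)_(x : T) labelled by a
   finite type T is C^T, with C = R[i].  Its vectors and operators are MathComp
   matrices of size #|T|, a label x : T being the index enum_rank x.  The space
   C^T1 (x) C^T2 has basis T1 * T2, and the k-fold tensor power of C^T has
   basis {ffun 'I_k -> T}; this avoids arithmetic codings of multi-indices. *)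
Notation hvec R T := 'cV[R[i]]_#|{: T}|.
Notation hop R T := 'M[R[i]]_#|{: T}|.

Section Hilbert.
Variable R : realType.

Definition mkvec (T : finType) (f : T -> R[i]) : hvec R T :=
  \col_i f (enum_val i).

Definition mkop (T : finType) (f : T -> T -> R[i]) : hop R T :=
  \matrix_(i, j) f (enum_val i) (enum_val j).

Definition vcoef (T : finType) (v : hvec R T) (x : T) : R[i] :=
  v (enum_rank x) 0.

Definition ocoef (T : finType) (M : hop R T) (x y : T) : R[i] :=
  M (enum_rank x) (enum_rank y).

Definition sqnorm (T : finType) (v : hvec R T) : R[i] := \tr (v^t* *m v).

Definition is_state (T : finType) (v : hvec R T) : Prop := sqnorm v = 1.

(* |v><v| *)
Definition proj1 (T : finType) (v : hvec R T) : hop R T := v *m v^t*.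

Definition tensv (T1 T2 : finType) (v : hvec R T1) (w : hvec R T2) :
    hvec R (T1 * T2) :=
  mkvec (fun x : T1 * T2 => vcoef v x.1 * vcoef w x.2).

Definition tenso (T1 T2 : finType) (M : hop R T1) (N : hop R T2) :
    hop R (T1 * T2) :=
  mkop (fun x y : T1 * T2 => ocoef M x.1 y.1 * ocoef N x.2 y.2).

(* v_0 (x) ... (x) v_(k-1) *)
Definition bigtensv (k : nat) (T : finType) (v : 'I_k -> hvec R T) :
    hvec R {ffun 'I_k -> T} :=
  mkvec (fun x : {ffun 'I_k -> T} => \prod_(i < k) vcoef (v i) (x i)).

Definition tenso_pow (k : nat) (T : finType) (M : hop R T) :
    hop R {ffun 'I_k -> T} :=
  mkop (fun x y : {ffun 'I_k -> T} => \prod_(i < k) ocoef M (x i) (y i)).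

Definition ptrace1 (A B : finType) (M : hop R (A * B)) : hop R B :=
  mkop (fun b b' => \sum_(a : A) ocoef M (a, b) (a, b')).

(* W(pi) sends the basis vector |x_0, ..., x_(k-1)> to the basis vector whose
   i-th factor is x_(pi^-1 i); see permW_bigtensv. *)
Definition permW (k : nat) (T : finType) (p : 'S_k) :
    hop R {ffun 'I_k -> T} :=
  mkop (fun y x : {ffun 'I_k -> T} => (y == [ffun i => x ((p^-1)%g i)])%:R).

Lemma permW_bigtensv (k : nat) (T : finType) (p : 'S_k)
    (v : 'I_k -> hvec R T) :
  permW T p *m bigtensv v = bigtensv (fun i => v ((p^-1)%g i)).
Proof.
apply/matrixP => r j; rewrite !mxE; set y := enum_val r.
pose z : {ffun 'I_k -> T} := [ffun i => y (p i)].
rewrite (bigD1 (enum_rank z)) //= big1 ?addr0.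
  rewrite !mxE !enum_rankK (_ : _ == _); last first.
    by apply/eqP/ffunP => i; rewrite !ffunE permKV.
  rewrite mul1r (reindex_inj (@perm_inj _ (p^-1)%g)).
  by apply: eq_bigr => i _; rewrite ffunE permKV.
move=> s nes; rewrite !mxE -/y; case: eqP => [ey|_]; last by rewrite mul0r.
case/negP: nes; apply/eqP/enum_val_inj; rewrite enum_rankK.
by apply/ffunP => i; rewrite ffunE ey ffunE permK.
Qed.

Definition PiG (k : nat) (T : finType) (G : {group 'S_k}) :
    hop R {ffun 'I_k -> T} :=
  (#|G|%:R)^-1 *: \sum_(g in G) permW T g.

Definition sep_accept (k : nat) (G : {group 'S_k}) (A B : finType)
    (psi : hvec R (A * B)) : R[i] :=
  \tr (PiG B G *m tenso_pow k (ptrace1 (proj1 psi))).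

(* psi^(x)k, with its factors regrouped as H_A^(x)k (x) H_B^(x)k. *)
Definition copies (k : nat) (A B : finType) (psi : hvec R (A * B)) :
    hvec R ({ffun 'I_k -> A} * {ffun 'I_k -> B}) :=
  mkvec (fun x : {ffun 'I_k -> A} * {ffun 'I_k -> B} =>
           \prod_(i < k) vcoef psi (x.1 i, x.2 i)).

End Hilbert.

Record cswap (m k : nat) := CSwap {
  ctrl : 'I_m;
  tgt1 : 'I_k;
  tgt2 : 'I_k;
  _ : tgt1 != tgt2
}.

Section Circuit.
Variable R : realType.

(* The computational basis of m qubits is {ffun 'I_m -> bool}, with true for
   |1>.  The first gate of the list is applied first. *)
Record circuit (k : nat) := Circuit {
  nqubits : nat;
  chi : hvec R {ffun 'I_nqubits -> bool};
  gates : seq (cswap nqubits k);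
  _ : is_state chi
}.

(* |b><b| on qubit q, identity on the other qubits *)
Definition qubit_proj (m : nat) (q : 'I_m) (b : bool) :
    hop R {ffun 'I_m -> bool} :=
  mkop (fun x y : {ffun 'I_m -> bool} => ((x == y) && (x q == b))%:R).

Definition cswap_op (m k : nat) (A B : finType) (g : cswap m k) :
    hop R ({ffun 'I_m -> bool} * ({ffun 'I_k -> A} * {ffun 'I_k -> B})) :=
  tenso (qubit_proj (ctrl g) false) 1%:M +
  tenso (qubit_proj (ctrl g) true)
    (tenso 1%:M (permW R B (tperm (tgt1 g) (tgt2 g)))).

Definition final_state (k : nat) (c : circuit k) (A B : finType)
    (psi : hvec R (A * B)) :=
  foldl (fun v g => cswap_op A B g *m v) (tensv (chi c) (copies k psi))
    (gates c).

Definition circuit_accept (k : nat) (c : circuit k) (A B : finType)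
    (psi : hvec R (A * B)) : R[i] :=
  sqnorm (tenso (proj1 (chi c)) 1%:M *m final_state c psi).

Definition executes (k : nat) (c : circuit k) (G : {group 'S_k})
    (A B : finType) : Prop :=
  forall psi : hvec R (A * B), is_state psi ->
    circuit_accept c psi = sep_accept G psi.

Definition ngates (k : nat) (c : circuit k) : nat := size (gates c).

End Circuit.

Definition symG (k : nat) : {group 'S_k} := [set: 'S_k]%G.

(* ordS i = i + 1 mod k: the cycle (1 2 ... k) up to relabelling from 0 *)
Definition cycG (k : nat) : {group 'S_k} := <[perm (@ordS_inj k)]>%G.

(* Main.v *)
Require Import Defs.
From mathcomp Require Import all_boot all_order all_algebra all_fingroup.
From mathcomp Require Import cyclic.
From mathcomp Require Import all_classical all_reals all_analysis.

Import Order.TTheory GRing.Theory Num.Theory.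
Local Open Scope ring_scope.

(* On control bits x the gates apply W(p_x), p_x being the product of the
   transpositions selected by x.  If every g in G is p_x for some x, let chi be
   the uniform superposition of one such x per g: then <chi|U|chi> = Pi_G, and
   since Pi_G is a projection the test accepts with probability
   Tr[Pi_G rho^(x)k].  It remains to select all of G from few transpositions.
   For S_k, strip p to p * (n p(n)), read left to right, which fixes n, for
   n = k-1, ..., 0: this takes k gates (n i) for each n.  For C_k, write the
   exponent in binary: each c^(2^j), j <= log2 k, is a product of at most k
   transpositions that are switched on together. *)

(** * Permutations selected by the control bits of a list of controlled swaps *)

Definition selperm {m k : nat} (gs : seq (cswap m k)) (x : {ffun 'I_m -> bool})
    : 'S_k :=
  (\prod_(g <- gs) (if x (ctrl g) then tperm (tgt1 g) (tgt2 g) else 1))%g.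

(** Only covering is required: several [x] may select the same permutation, and some may select one
    outside [P]. The number [m] of control qubits is left free, since only gates are counted. *)
Definition selectable {k : nat} (N : nat) (P : 'S_k -> Prop) : Prop :=
  exists (m : nat) (gs : seq (cswap m k)), (size gs <= N)%N /\
    forall p, P p -> exists x, selperm gs x = p.

Definition recontrol {m m' k : nat} (f : 'I_m -> 'I_m') (g : cswap m k) :
    cswap m' k :=
  let: CSwap q a b neq_ab := g in CSwap (f q) neq_ab.

Lemma selperm_recontrol {m m' k : nat} (f : 'I_m -> 'I_m')
    (gs : seq (cswap m k)) (x : {ffun 'I_m' -> bool}) :
  selperm (map (recontrol f) gs) x = selperm gs [ffun q => x (f q)].
Proof.
by rewrite /selperm big_map; apply: eq_bigr => -[q a b neq_ab] _ /=; rewrite ffunE.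
Qed.

Lemma selectable_imply {k : nat} (N : nat) (P Q : 'S_k -> Prop) :
  (forall p, Q p -> P p) -> selectable N P -> selectable N Q.
Proof.
by move=> QP [m [gs [szgs gsP]]]; exists m, gs; split=> // p /QP/gsP.
Qed.

Lemma selectable_leq {k : nat} (N N' : nat) (P : 'S_k -> Prop) :
  (N <= N')%N -> selectable N P -> selectable N' P.
Proof.
by move=> leN [m [gs [szgs gsP]]]; exists m, gs; split=> //; apply: leq_trans leN.
Qed.

Lemma selectable_one {k : nat} : selectable 0 (fun p : 'S_k => p = 1%g).
Proof.
exists 0, [::]; split=> // p ->; exists [ffun=> false].
by rewrite /selperm big_nil.
Qed.

(** The two gate lists are put on disjoint control registers, so their bits are chosen
    independently. *)
Lemma selectableM {k : nat} (N1 N2 : nat) (P1 P2 : 'S_k -> Prop) :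
  selectable N1 P1 -> selectable N2 P2 ->
  selectable (N1 + N2)
    (fun p => exists p1 p2, [/\ P1 p1, P2 p2 & p = (p1 * p2)%g]).
Proof.
move=> [m1 [gs1 [sz1 gs1P]]] [m2 [gs2 [sz2 gs2P]]].
exists (m1 + m2)%N.
exists (map (recontrol (lshift m2)) gs1 ++ map (recontrol (@rshift m1 m2)) gs2).
split; first by rewrite size_cat !size_map leq_add.
move=> _ [p1 [p2 [/gs1P[x1 <-] /gs2P[x2 <-] ->]]].
pose x := [ffun q => match fintype.split q with inl q1 => x1 q1 | inr q2 => x2 q2 end].
exists x; transitivity (selperm (map (recontrol (lshift m2)) gs1) x *
    selperm (map (recontrol (@rshift m1 m2)) gs2) x)%g; first exact: big_cat.
rewrite !selperm_recontrol.
congr (selperm gs1 _ * selperm gs2 _)%g; apply/ffunP => q; rewrite !ffunE.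
  by rewrite (unsplitK (inl q)).
by rewrite (unsplitK (inr q)).
Qed.

(** A single qubit controls all the gates and switches the whole product on or off. *)
Lemma selectable_prod_tperm {k : nat} (ts : seq ('I_k * 'I_k)) :
  selectable (size ts)
    (fun p => p = 1%g \/ p = (\prod_(t <- ts) tperm t.1 t.2)%g).
Proof.
suff [gs szgs gsE] : exists2 gs : seq (cswap 1 k), (size gs <= size ts)%N &
    forall x, selperm gs x =
      if x ord0 then (\prod_(t <- ts) tperm t.1 t.2)%g else 1%g.
  exists 1, gs; split=> // p [] ->.
    by exists [ffun=> false]; rewrite gsE ffunE.
  by exists [ffun=> true]; rewrite gsE ffunE.
elim: ts => [|[a b] ts [gs szgs gsE]].
  by exists [::] => // x; rewrite /selperm !big_nil if_same.
(* A pair with equal entries is not a legal gate; it stands for the identity and is dropped. *)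
have [<-|neq_ab] := eqVneq a b.
  by exists gs => [|x]; [exact: leqW | rewrite gsE big_cons tperm1 mul1g].
exists (CSwap ord0 neq_ab :: gs) => // x.
rewrite /selperm !big_cons -/(selperm gs x) gsE /=.
by case: ifP; rewrite ?mulg1.
Qed.

(** The transposition sends [p j] back to [j]. It moves no [i > j], because [p i = i] and
    injectivity of [p] exclude [p j = i]. *)
Lemma perm_fix_geS {k : nat} (p : 'S_k) (j : 'I_k) :
  (forall i : 'I_k, (j < i)%N -> p i = i) ->
  forall i : 'I_k, (j <= i)%N -> (p * tperm j (p j))%g i = i.
Proof.
move=> pfix i; rewrite leq_eqVlt permM => /predU1P[/val_inj <-|lt_ji].
  exact: tpermR.
rewrite (pfix i) // tpermD //; apply: contraTN lt_ji => /eqP.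
  by move=> <-; rewrite ltnn.
move=> pji; rewrite -leqNgt leqNgt; apply/negP => lt_ji.
have /perm_inj ij : p i = p j by rewrite pfix.
by rewrite ij ltnn in lt_ji.
Qed.

Lemma perm_fix_ge0 {k : nat} (p : 'S_k) :
  (forall i : 'I_k, (0 <= i)%N -> p i = i) -> p = 1%g.
Proof. by move=> pfix; apply/permP => i; rewrite pfix // perm1. Qed.

Lemma prod_tperm_fix_ge {k n : nat} (p : 'S_k) : (n <= k)%N ->
  (forall i : 'I_k, (n <= i)%N -> p i = i) ->
  exists2 ts : seq ('I_k * 'I_k), (size ts <= n)%N &
    p = (\prod_(t <- ts) tperm t.1 t.2)%g.
Proof.
elim: n p => [|n IHn] p le_nk pfix.
  by exists [::]; rewrite // big_nil (perm_fix_ge0 p).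
pose j := Ordinal le_nk.
have [ts szts tsE] := IHn _ (ltnW le_nk) (perm_fix_geS p j pfix).
exists (rcons ts (j, p j)); first by rewrite size_rcons.
by rewrite -cats1 big_cat big_seq1 -tsE /= -mulgA tperm2 mulg1.
Qed.

Lemma selectable_perm {k : nat} (p : 'S_k) :
  selectable k (fun q => q = 1%g \/ q = p).
Proof.
have [|ts szts ->] := prod_tperm_fix_ge p (leqnn k).
  by move=> i; rewrite leqNgt ltn_ord.
exact: selectable_leq szts (selectable_prod_tperm ts).
Qed.

(** Each [i] gets its own control qubit, and at most one of them is switched on. *)
Lemma selectable_tpermsl {k : nat} (j : 'I_k) :
  selectable k (fun p => exists i, p = tperm j i).
Proof.
(* Adding the identity makes the induction work: either the head or the tail of [s] can be left
   switched off. *)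
suff sel (s : seq 'I_k) : selectable (size s)
    (fun p => p = 1%g \/ exists2 i, i \in s & p = tperm j i).
  apply: selectable_leq (_ : (size (enum 'I_k) <= k)%N) _.
    by rewrite size_enum_ord.
  apply: selectable_imply (sel _) => _ [i ->].
  by right; exists i; rewrite ?mem_enum.
elim: s => [|i s IHs].
  by apply: selectable_imply selectable_one => p [|[]].
apply: selectable_imply (selectableM _ _ _ _ (selectable_prod_tperm [:: (j, i)]) IHs).
move=> p; rewrite big_seq1 => -[->|[i' + ->]].
  by exists 1%g, 1%g; split; [left | left | rewrite mulg1].
rewrite inE => /predU1P[->|s_i'].
  by exists (tperm j i), 1%g; split; [right | left | rewrite mulg1].
by exists 1%g, (tperm j i'); split; [left | right; exists i' | rewrite mul1g].
Qed.

Lemma selectable_sym (k : nat) : selectable (k * k) (fun p : 'S_k => True).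
Proof.
suff sel n : (n <= k)%N -> selectable (n * k)
    (fun p : 'S_k => forall i : 'I_k, (n <= i)%N -> p i = i).
  by apply: selectable_imply (sel k _) => // p _ i; rewrite leqNgt ltn_ord.
elim: n => [|n IHn] le_nk.
  by apply: selectable_imply selectable_one => p; apply: perm_fix_ge0.
pose j := Ordinal le_nk; rewrite mulSn addnC.
apply: selectable_imply (selectableM _ _ _ _ (IHn (ltnW le_nk)) (selectable_tpermsl j)).
move=> p pfix; exists (p * tperm j (p j))%g, (tperm j (p j)).
split; [exact: (perm_fix_geS p j) | by exists (p j) |].
by rewrite -mulgA tperm2 mulg1.
Qed.

(** Each binary digit of [n] costs one block of [k] gates; the induction splits off the leading
    digit, which switches [p ^+ (2 ^ L)]. *)
Lemma selectable_powers {k : nat} (p : 'S_k) (L : nat) :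
  selectable (L * k) (fun q => exists2 n, (n < 2 ^ L)%N & q = (p ^+ n)%g).
Proof.
elim: L => [|L IHL].
  apply: selectable_imply selectable_one => q [n].
  by rewrite expn0 ltnS leqn0 => /eqP -> ->.
rewrite mulSn.
apply: selectable_imply (selectableM _ _ _ _ (selectable_perm (p ^+ (2 ^ L))%g) IHL).
move=> q [n lt_n ->]; case: (ltnP n (2 ^ L)) => [lt_nL|le_Ln].
  by exists 1%g, (p ^+ n)%g; split; [left | exists n | rewrite mul1g].
exists (p ^+ (2 ^ L))%g, (p ^+ (n - 2 ^ L))%g; split; first by right.
  by exists (n - 2 ^ L)%N; rewrite // ltn_subLR // addnn -mul2n -expnS.
by rewrite -expgD subnKC.
Qed.

(** The [n]-th power of the cycle is [i -> i + n] mod [k], so its [k]-th power is the identity. *)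
Lemma order_perm_ordS (k : nat) : (0 < k)%N -> (#[perm (@ordS_inj k)]%g <= k)%N.
Proof.
move=> k_gt0; apply: dvdn_leq => //; rewrite order_dvdn; apply/eqP/permP => i.
have iter_ordS n : val ((perm (@ordS_inj k) ^+ n)%g i) = ((i + n) %% k)%N.
  elim: n => [|n IHn]; first by rewrite expg0 perm1 addn0 modn_small.
  by rewrite expgSr permM permE /= IHn -[in LHS]addn1 modnDml addn1 addnS.
by apply: val_inj; rewrite iter_ordS modnDr perm1 modn_small.
Qed.

Lemma selectable_cyc (k : nat) : (0 < k)%N ->
  selectable ((trunc_log 2 k).+1 * k) (fun p => p \in cycG k).
Proof.
move=> k_gt0; apply: selectable_imply (selectable_powers (perm (@ordS_inj k)) _).
move=> _ /cyclePmin[n lt_n ->]; exists n => //.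
(* The exponents stay below the order, hence below [k < 2 ^ (trunc_log 2 k).+1]. *)
apply: leq_ltn_trans (trunc_log_ltn k (isT : (1 < 2)%N)).
exact: leq_trans (ltnW lt_n) (order_perm_ordS k k_gt0).
Qed.


(** * Coordinates of vectors and operators in the labelled bases *)

Section Coefficients.
Local Open Scope complex_scope.
Context {R : realType}.

Lemma vcoefE {T : finType} (f : T -> R[i]) (x : T) : vcoef (mkvec f) x = f x.
Proof. by rewrite /vcoef mxE enum_rankK. Qed.

Lemma ocoefE {T : finType} (f : T -> T -> R[i]) (x y : T) :
  ocoef (mkop f) x y = f x y.
Proof. by rewrite /ocoef mxE !enum_rankK. Qed.

Lemma ocoefD {T : finType} (M N : hop R T) (x y : T) :
  ocoef (M + N) x y = ocoef M x y + ocoef N x y.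
Proof. by rewrite /ocoef mxE. Qed.

Lemma ocoef1 {T : finType} (x y : T) : ocoef (1%:M : hop R T) x y = (x == y)%:R.
Proof. by rewrite /ocoef mxE (inj_eq enum_rank_inj). Qed.

Lemma sum_enum_rank {T : finType} (F : 'I_#|T| -> R[i]) :
  \sum_i F i = \sum_(x : T) F (enum_rank x).
Proof. by rewrite (reindex (@enum_rank T)) //; apply/onW_bij/enum_rank_bij. Qed.

Lemma vcoef_mulmx {T : finType} (M : hop R T) (v : hvec R T) (x : T) :
  vcoef (M *m v) x = \sum_y ocoef M x y * vcoef v y.
Proof. by rewrite /vcoef mxE sum_enum_rank. Qed.

Lemma sqnormE {T : finType} (v : hvec R T) :
  sqnorm v = \sum_x (vcoef v x)^* * vcoef v x.
Proof.
rewrite /sqnorm /mxtrace big_ord1 mxE sum_enum_rank.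
by apply: eq_bigr => x _; rewrite !mxE.
Qed.

Lemma ocoef_proj1 {T : finType} (v : hvec R T) (x y : T) :
  ocoef (proj1 v) x y = vcoef v x * (vcoef v y)^*.
Proof. by rewrite /ocoef mxE big_ord1 !mxE. Qed.

Lemma mxtrace_mulE {T : finType} (M N : hop R T) :
  \tr (M *m N) = \sum_x \sum_y ocoef M x y * ocoef N y x.
Proof.
rewrite /mxtrace sum_enum_rank; apply: eq_bigr => x _.
by rewrite mxE sum_enum_rank.
Qed.

Lemma ocoef_tenso {T1 T2 : finType} (M : hop R T1) (N : hop R T2) x y :
  ocoef (tenso M N) x y = ocoef M x.1 y.1 * ocoef N x.2 y.2.
Proof. exact: ocoefE. Qed.

Lemma ocoef_tenso_pow {k : nat} {T : finType} (M : hop R T) x y :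
  ocoef (tenso_pow k M) x y = \prod_(i < k) ocoef M (x i) (y i).
Proof. exact: ocoefE. Qed.

Lemma ocoef_ptrace1 {A B : finType} (M : hop R (A * B)) b b' :
  ocoef (ptrace1 M) b b' = \sum_a ocoef M (a, b) (a, b').
Proof. exact: ocoefE. Qed.

Lemma ocoef_qubit_proj {m : nat} (q : 'I_m) (b : bool) x y :
  ocoef (qubit_proj R q b) x y = ((x == y) && (x q == b))%:R.
Proof. exact: ocoefE. Qed.

(** Coordinate [b] of [W(p) v] is coordinate [permf b p] of [v]. *)
Definition permf {k : nat} {T : finType} (b : {ffun 'I_k -> T}) (p : 'S_k) :
  {ffun 'I_k -> T} := [ffun i => b (p i)].

Lemma permfM {k : nat} {T : finType} (b : {ffun 'I_k -> T}) (p q : 'S_k) :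
  permf (permf b q) p = permf b (p * q)%g.
Proof. by apply/ffunP => i; rewrite !ffunE permM. Qed.

Lemma permf1 {k : nat} {T : finType} (b : {ffun 'I_k -> T}) : permf b 1%g = b.
Proof. by apply/ffunP => i; rewrite ffunE perm1. Qed.

Lemma permfK {k : nat} {T : finType} (p : 'S_k) :
  cancel (fun b : {ffun 'I_k -> T} => permf b p) (fun b => permf b (p^-1)%g).
Proof. by move=> b; rewrite permfM mulVg permf1. Qed.

Lemma permfKV {k : nat} {T : finType} (p : 'S_k) :
  cancel (fun b : {ffun 'I_k -> T} => permf b (p^-1)%g) (fun b => permf b p).
Proof. by move=> b; rewrite permfM mulgV permf1. Qed.

Lemma permf_inj {k : nat} {T : finType} (p : 'S_k) :
  injective (fun b : {ffun 'I_k -> T} => permf b p).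
Proof. exact: can_inj (permfK p). Qed.

Lemma ocoef_permW {k : nat} {T : finType} (p : 'S_k) (y x : {ffun 'I_k -> T}) :
  ocoef (permW R T p) y x = (x == permf y p)%:R.
Proof.
rewrite /permW ocoefE -[LHS]/((y == permf x (p^-1)%g)%:R).
by rewrite -(inj_eq (permf_inj p)) permfKV eq_sym.
Qed.

Lemma sum_eq_mull {T : finType} (x : T) (F : T -> R[i]) :
  \sum_y (y == x)%:R * F y = F x.
Proof.
rewrite (bigD1 x) //= eqxx mul1r big1 ?addr0 // => y /negbTE ->.
by rewrite mul0r.
Qed.

End Coefficients.

(** * Acceptance probabilities of the circuit and of the separability test in coordinates *)

Section Circuits.
Local Open Scope complex_scope.
Context {R : realType} {k : nat} {A B : finType}.

Lemma vcoef_cswap_op {m : nat} (g : cswap m k)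
    (v : hvec R ({ffun 'I_m -> bool} * ({ffun 'I_k -> A} * {ffun 'I_k -> B})))
    x a b :
  vcoef (cswap_op R A B g *m v) (x, (a, b)) =
  vcoef v (x, (a, permf b (if x (ctrl g) then tperm (tgt1 g) (tgt2 g) else 1%g))).
Proof.
rewrite vcoef_mulmx -[RHS](sum_eq_mull _ (vcoef v)); apply: eq_bigr => -[y [a' b']] _.
congr (_ * _); rewrite ocoefD !ocoef_tenso !ocoef_qubit_proj !ocoef1 /= ocoef_permW.
rewrite !xpair_eqE [a == _]eq_sym [b == _]eq_sym [x == y]eq_sym.
case: (y == x); rewrite ?mul0r ?addr0 //=.
by case: (x (ctrl g)); rewrite ?permf1 ?mul0r ?mul1r ?add0r ?addr0 -?natrM ?mulnb.
Qed.

(** The gates never change the control bits, so each branch [x] evolves separately. Indices are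
    pulled back through the last gate first, which makes the first gate the leftmost factor of
    [selperm]. *)
Lemma vcoef_final_state (c : circuit R k) (psi : hvec R (A * B)) x a b :
  vcoef (final_state c psi) (x, (a, b)) =
  vcoef (chi c) x * vcoef (copies k psi) (a, permf b (selperm (gates c) x)).
Proof.
rewrite /final_state; set v0 := tensv _ _.
transitivity (vcoef v0 (x, (a, permf b (selperm (gates c) x)))); last exact: vcoefE.
elim: (gates c) v0 => [|g gs IHgs] v0 /=.
  by rewrite /selperm big_nil permf1.
by rewrite IHgs vcoef_cswap_op permfM /selperm big_cons.
Qed.

(** Projecting the control register onto [chi] leaves the product vector of [chi] and [Phi]; since
    [chi] is normalized, only the squared norm of [Phi] remains. *)
Lemma circuit_acceptE (c : circuit R k) (psi : hvec R (A * B)) :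
  let Phi a b := \sum_x (vcoef (chi c) x)^* * vcoef (chi c) x *
    vcoef (copies k psi) (a, permf b (selperm (gates c) x)) in
  circuit_accept c psi = \sum_a \sum_b (Phi a b)^* * Phi a b.
Proof.
move=> Phi; rewrite /circuit_accept sqnormE.
have coefE x a b : vcoef (tenso (proj1 (chi c)) 1%:M *m final_state c psi)
    (x, (a, b)) = vcoef (chi c) x * Phi a b.
  rewrite vcoef_mulmx mulr_sumr.
  transitivity (\sum_y \sum_z ocoef (tenso (proj1 (chi c)) 1%:M) (x, (a, b)) (y, z)
      * vcoef (final_state c psi) (y, z)).
    by rewrite pair_bigA; apply: eq_bigr => -[y z].
  apply: eq_bigr => y _.
  transitivity (\sum_z (z == (a, b))%:R * (vcoef (chi c) x * (vcoef (chi c) y)^*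
      * vcoef (final_state c psi) (y, z))).
    apply: eq_bigr => z _; rewrite ocoef_tenso ocoef_proj1 ocoef1 eq_sym /=.
    by rewrite mulrCA !mulrA.
  by rewrite sum_eq_mull vcoef_final_state !mulrA.
transitivity (\sum_x \sum_a \sum_b ((vcoef (chi c) x)^* * vcoef (chi c) x) *
    ((Phi a b)^* * Phi a b)).
  under [RHS]eq_bigr do rewrite pair_bigA.
  rewrite pair_bigA; apply: eq_bigr => -[x [a b]] _ /=.
  by rewrite coefE rmorphM mulrACA.
under eq_bigr do [under eq_bigr do rewrite -mulr_sumr]; rewrite -?mulr_sumr.
under eq_bigr do rewrite -mulr_sumr.
by rewrite -mulr_suml -sqnormE; case: (c) => m v gs /= ->; rewrite mul1r.
Qed.

(** The trace of [W(g)] against the tensor power of the reduced state is the expectation of [W(g)]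
    on the B factors of the copies. *)
Lemma sep_acceptE (G : {group 'S_k}) (psi : hvec R (A * B)) :
  sep_accept G psi = #|G|%:R^-1 * \sum_(g in G) \sum_a \sum_b
    (vcoef (copies k psi) (a, b))^* * vcoef (copies k psi) (a, permf b g).
Proof.
rewrite /sep_accept /PiG -scalemxAl mxtraceZ; congr (_ * _).
rewrite mulmx_suml raddf_sum; apply: eq_bigr => g _ /=.
rewrite mxtrace_mulE [RHS]exchange_big; apply: eq_bigr => b _ /=.
under eq_bigr do rewrite ocoef_permW.
rewrite sum_eq_mull ocoef_tenso_pow.
under [LHS]eq_bigr do rewrite ocoef_ptrace1.
(* The product over copies of partial-trace sums becomes one sum over the multi-indices [a]. *)
rewrite bigA_distr_bigA; apply: eq_bigr => a _ /=.
rewrite !vcoefE rmorph_prod -big_split; apply: eq_bigr => i _ /=.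
by rewrite ocoef_proj1 mulrC ffunE.
Qed.

End Circuits.

(** * From a selection of the group to a circuit executing its test *)

Section Execution.
Local Open Scope complex_scope.
Context {R : realType} {k : nat}.

(** This is [<Pi f, Pi f> = <f, Pi f>] for the projection [Pi] onto [G]-invariant functions: [avg]
    is invariant, so reindexing by [h] removes [h] from the other factor. *)
Lemma sum_norm_orbit_average {T : finType} (G : {group 'S_k})
    (f : {ffun 'I_k -> T} -> R[i]) :
  let avg b := #|G|%:R^-1 * \sum_(g in G) f (permf b g) in
  \sum_b (avg b)^* * avg b = \sum_b (f b)^* * avg b.
Proof.
move=> avg.
have avg_permf b h : h \in G -> avg (permf b h) = avg b.
  move=> Gh; congr (_ * _); rewrite [RHS](reindex_inj (mulIg h)) /=.
  by apply: eq_big => g; [rewrite groupMr | rewrite permfM].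
have G_neq0 : #|G|%:R != 0 :> R[i] by rewrite pnatr_eq0 -lt0n cardG_gt0.
transitivity (#|G|%:R^-1 * \sum_(h in G) \sum_b (f (permf b h))^* * avg b).
  rewrite exchange_big mulr_sumr; apply: eq_bigr => b _ /=.
  rewrite -mulr_suml [RHS]mulrA; congr (_ * _).
  by rewrite rmorphM rmorph_sum fmorphV rmorph_nat.
transitivity (#|G|%:R^-1 * \sum_(h in G) \sum_b (f b)^* * avg b).
  congr (_ * _); apply: eq_bigr => h Gh.
  rewrite [RHS](reindex_inj (permf_inj h)) /=.
  by apply: eq_bigr => b _; rewrite avg_permf.
by rewrite sumr_const -[X in _ * X]mulr_natl mulrA mulVf ?mul1r.
Qed.

Lemma selectable_circuit (N : nat) (G : {group 'S_k}) :
  selectable N (fun p => p \in G) ->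
  exists c : circuit R k,
    (forall A B : finType, executes c G A B) /\ (ngates c <= N)%N.
Proof.
move=> [m [gs [szgs gsP]]].
(* One bit string is chosen per permutation; the default is never reached for [p] in [G]. *)
pose X p : {ffun 'I_m -> bool} := odflt [ffun=> false] [pick x | selperm gs x == p].
have XK p : p \in G -> selperm gs (X p) = p.
  move=> /gsP[x xp]; rewrite /X; case: pickP => [y /eqP //|/(_ x)].
  by rewrite xp eqxx.
(* [S] is the image of [G] under [X], the support of the control state. *)
pose S x := (X (selperm gs x) == x) && (selperm gs x \in G).
pose v : hvec R {ffun 'I_m -> bool} :=
  mkvec (fun x => (S x)%:R * sqrtC (#|G|%:R^-1)).
have G_neq0 : #|G|%:R != 0 :> R[i] by rewrite pnatr_eq0 -lt0n cardG_gt0.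
have weightE x : (vcoef v x)^* * vcoef v x = (S x)%:R * #|G|%:R^-1.
  rewrite vcoefE rmorphM rmorph_nat mulrACA -natrM mulnb andbb; congr (_ * _).
  rewrite -[RHS]sqrtCK expr2; congr (_ * _); apply: geC0_conj.
  by rewrite sqrtC_ge0 invr_ge0 ler0n.
have sum_weight F : \sum_x (vcoef v x)^* * vcoef v x * F (selperm gs x) =
    #|G|%:R^-1 * \sum_(g in G) F g.
  transitivity (#|G|%:R^-1 * \sum_(x | S x) F (selperm gs x)).
    rewrite [in RHS]big_mkcond [RHS]mulr_sumr; apply: eq_bigr => x _; rewrite weightE.
    by case: (S x); rewrite !(mul0r, mul1r, mulr0).
  (* [X] and [selperm gs] are inverse bijections between [G] and [S]. *)
  congr (_ * _); rewrite (reindex_onto X (selperm gs)) => [|x /andP[/eqP]//].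
  apply: eq_big => [g|g /andP[_ /eqP -> //]].
  apply/andP/idP => [[/andP[_ Gg] /eqP gE]|Gg]; first by rewrite -gE.
  by rewrite /S XK // !eqxx.
(* Normalization is the weighted sum of the constant function 1. *)
have state_v : is_state v.
  rewrite /is_state sqnormE; have := sum_weight (fun=> 1).
  under eq_bigr do rewrite mulr1.
  by move=> ->; rewrite sumr_const mulVf.
exists (Circuit gs state_v); split=> // A B psi _.
rewrite circuit_acceptE sep_acceptE.
transitivity (\sum_a \sum_b (vcoef (copies k psi) (a, b))^* *
    (#|G|%:R^-1 * \sum_(g in G) vcoef (copies k psi) (a, permf b g))).
  apply: eq_bigr => a _; rewrite -sum_norm_orbit_average.
  apply: eq_bigr => b _ /=.
  by rewrite (sum_weight (fun p => vcoef (copies k psi) (a, permf b p))).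
rewrite mulr_sumr.
under [RHS]eq_bigr do rewrite mulr_sumr.
rewrite [RHS]exchange_big; apply: eq_bigr => a _ /=.
under [RHS]eq_bigr do rewrite mulr_sumr.
rewrite [RHS]exchange_big; apply: eq_bigr => b _ /=.
by rewrite mulrCA !mulr_sumr.
Qed.

End Execution.

(** * Gate counts and absolute constants *)

Lemma trunc_log2_ln_le (R : realType) (k : nat) : (0 < k)%N ->
  (trunc_log 2 k)%:R * ln 2 <= ln k%:R :> R.
Proof.
move=> k_gt0; rewrite mulr_natl -lnXn // -natrX ler_ln ?posrE ?ltr0n ?expn_gt0 //.
by rewrite ler_nat trunc_logP.
Qed.

Theorem mainTheorem6 (R : realType) :
  (exists c : R, forall (k dA dB : nat), (2 <= k)%N ->
     exists t : circuit R k,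
       executes t (symG k) 'I_dA 'I_dB /\
       (ngates t)%:R <= c * (k%:R ^+ 2)) /\
  (exists c : R, forall (k dA dB : nat), (2 <= k)%N ->
     exists t : circuit R k,
       executes t (cycG k) 'I_dA 'I_dB /\
       (ngates t)%:R <= c * (k%:R * ln k%:R)).
Proof.
split.
  exists 1 => k dA dB _.
  have [|t [tG szt]] := @selectable_circuit R k (k * k) (symG k).
    exact: selectable_imply (selectable_sym k).
  exists t; split; first exact: tG.
  by rewrite mul1r -natrX ler_nat -mulnn.
have ln2_gt0 : 0 < ln 2 :> R by rewrite ln_gt0 // ltr1n.
(* The 2 absorbs the successor in [(trunc_log 2 k).+1], as the logarithm is at least 1 for [k >= 2];
   dividing by [ln 2] passes from binary to natural logarithms. *)
exists (2 / ln 2) => k dA dB k_gt1.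
have k_gt0 : (0 < k)%N by apply: ltnW.
have [t [tG szt]] := @selectable_circuit R k _ _ (selectable_cyc k k_gt0).
exists t; split; first exact: tG.
have log_gt0 : (0 < trunc_log 2 k)%N by rewrite trunc_log_gt0.
apply: (@le_trans _ _ (k%:R * (2 * (trunc_log 2 k)%:R))).
  rewrite -!natrM ler_nat (leq_trans szt) // mulnC leq_mul2l; apply/orP; right.
  by rewrite mul2n -addnn -addn1 leq_add2l.
rewrite [leRHS]mulrCA ler_wpM2l // -mulrA ler_wpM2l // mulrC ler_pdivlMr //.
exact: trunc_log2_ln_le.
Qed.
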